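(* Cut elimination on proof nets for multiplicative linear logic with units is strongly normalising: starting from any proof net on any cut sequent, every sequence of successive cut eliminations terminates.
   Context: Formulas (MLL) are built from literals (propositional variables $P,Q,\dots$ and their duals $P^\bot,Q^\bot,\dots$) and units $1,\bot$ by the binary connectives $\otimes$ (tensor) and $\wp$ (par, the multiplicative disjunction of linear logic). An atom is a literal or a unit. Negation $(-)^\bot$ extends to all formulas by $P^{\bot\bot}=P$, $\bot^\bot=1$, $1^\bot=\bot$, $(A\otimes B)^\bot=A^\bot\wp B^\bot$, $(A\wp B)^\bot=A^\bot\otimes B^\bot$. A formula is identified with its parse tree (leaves labelled by atoms, internal vertices by connectives). A leaf (or atom) is positive if labelled by a propositional variable or $1$, and negative if labelled by a dual $P^\bot$ or by $\bot$. A sequent is a non-empty disjoint union of formulas (a labelled forest). A cut pair on $A$ is the disjoint union of $A$ and $A^\bot$ together with an undirected edge (a cut) between their roots. A cut sequent is a disjoint union of a sequent and zero or more cut pairs. A switching of a cut sequent is any subgraph obtained by deleting, for each $\wp$ vertex, one of its two argument edges. A leaf function on a cut sequent is a function from its negative leaves to its positive leaves. A proof net on a cut sequent $\Gamma$ is a leaf function $f$ on $\Gamma$ such that: (Matching) for every propositional variable $P$, $f$ restricts to a bijection between the $P^\bot$-labelled leaves and the $P$-labelled leaves of $\Gamma$; (Switching) for every switching $\Gamma'$ of $\Gamma$, the undirected graph obtained by adding the edges $\{l,f(l)\}$ of $f$ to $\Gamma'$ is a tree (acyclic and connected; parallel edges count as a cycle). Eliminating a cut. Let $f$ be a proof net on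 the cut sequent consisting of $\Gamma$ and a cut pair on $A$. - Atom: if $A$ is an atom, say (without loss of generality) positive, delete the cut pair $A,A^\bot$, and reset every edge of $f$ targeting the leaf $A$ to target $f(A^\bot)$ instead. - Compound: if $A$ is compound, say (without loss of generality) $A=B\otimes C$ and $A^\bot=B^\bot\wp C^\bot$, replace the cut pair on $A$ by two cut pairs, one on $B$ (joining the roots of $B$ and $B^\bot$) and one on $C$ (joining the roots of $C$ and $C^\bot$); the leaves and the function $f$ are unchanged. The result of eliminating a cut from a proof net is again a proof net. *)

(* Defs.v *)
From HB Require Import structures.
From mathcomp Require Import all_boot.
Set Implicit Arguments.
Unset Strict Implicit.
Unset Printing Implicit Defensive.

Inductive atom (X : Type) := Var of X | NVar of X | One | Bot.
Arguments One {X}.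
Arguments Bot {X}.

Section AtomEq.
Variable X : eqType.

Definition atom_encode (a : atom X) : bool * option X :=
  match a with
  | Var P => (true, Some P)
  | NVar P => (false, Some P)
  | One => (true, None)
  | Bot => (false, None)
  end.

Definition atom_decode (c : bool * option X) : atom X :=
  match c with
  | (true, Some P) => Var P
  | (false, Some P) => NVar P
  | (true, None) => One
  | (false, None) => Bot
  end.

Lemma atom_encodeK : cancel atom_encode atom_decode. Proof. by case. Qed.

HB.instance Definition _ := Equality.copy (atom X) (can_type atom_encodeK).
End AtomEq.

Inductive formula (X : Type) :=
  | Atom of atom X
  | Tensor of formula X & formula X
  | Par of formula X & formula X.

Definition positive X (a : atom X) : bool :=
  match a with Var _ | One => true | NVar _ | Bot => false end.

Definition dual_atom X (a : atom X) : atom X :=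
  match a with Var P => NVar P | NVar P => Var P | One => Bot | Bot => One end.

Fixpoint dual X (A : formula X) : formula X :=
  match A with
  | Atom a => Atom (dual_atom a)
  | Tensor B C => Par (dual B) (dual C)
  | Par B C => Tensor (dual B) (dual C)
  end.

Lemma dualK X : involutive (@dual X).
Proof. by elim=> [[]|B IB C IC|B IB C IC] //=; rewrite IB IC. Qed.

(* An occurrence of a formula: its parse tree with every vertex named by an   *)
(* element of V. Disjointness of a union of parse trees is distinctness of    *)
(* the names, so leaves keep their identity when a cut is eliminated.         *)
Inductive occ (X V : Type) :=
  | OLeaf of V & atom X
  | OTensor of V & occ X V & occ X V
  | OPar of V & occ X V & occ X V.

Section Occurrences.
Variables X V : Type.
Implicit Type t : occ X V.

Fixpoint formula_of t : formula X :=
  match t with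
  | OLeaf _ a => Atom a
  | OTensor _ l r => Tensor (formula_of l) (formula_of r)
  | OPar _ l r => Par (formula_of l) (formula_of r)
  end.

Definition root_of t : V :=
  match t with OLeaf v _ | OTensor v _ _ | OPar v _ _ => v end.

Fixpoint occ_vertices t : seq V :=
  match t with
  | OLeaf v _ => [:: v]
  | OTensor v l r | OPar v l r => v :: occ_vertices l ++ occ_vertices r
  end.

Fixpoint occ_leaves t : seq (V * atom X) :=
  match t with
  | OLeaf v a => [:: (v, a)]
  | OTensor _ l r | OPar _ l r => occ_leaves l ++ occ_leaves r
  end.

(* The edges kept by the switching sw: the par vertex v keeps its edge to the *)
(* left argument if sw v, and its edge to the right argument otherwise.       *)
Fixpoint occ_edges (sw : V -> bool) t : seq (V * V) :=
  match t with
  | OLeaf _ _ => [::]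
  | OTensor v l r => [:: (v, root_of l), (v, root_of r)
                       & occ_edges sw l ++ occ_edges sw r]
  | OPar v l r => (v, root_of (if sw v then l else r))
                    :: occ_edges sw l ++ occ_edges sw r
  end.
End Occurrences.

(* Neither the order of the two lists nor that of the members of a pair in    *)
(* [cuts] is meaningful; a cut joins the roots of the two trees of its pair.  *)
Record cut_forest (X V : Type) := CutForest {
  concls : seq (occ X V);
  cuts : seq (occ X V * occ X V)
}.

Section CutSequents.
Variables X V : eqType.
Implicit Type G : cut_forest X V.

Definition trees G : seq (occ X V) :=
  concls G ++ flatten [seq [:: k.1; k.2] | k <- cuts G].

Definition vertices G : seq V := flatten (map (@occ_vertices X V) (trees G)).

Definition leaves G : seq (V * atom X) :=
  flatten (map (@occ_leaves X V) (trees G)).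

Definition cut_sequent G : Prop :=
  [/\ concls G <> [::],
      uniq (vertices G)
    & forall i t u, onth (cuts G) i = Some (t, u) ->
        formula_of u = dual (formula_of t)].

Definition labelled G (a : atom X) : seq V :=
  [seq l.1 | l <- leaves G & l.2 == a].

Definition pos_leaves G : seq V := [seq l.1 | l <- leaves G & positive l.2].

Definition neg_leaves G : seq V := [seq l.1 | l <- leaves G & ~~ positive l.2].

(* A leaf function is represented by any f : V -> V extending it: values      *)
(* outside neg_leaves G are irrelevant.                                       *)
Definition leaf_function G (f : V -> V) : Prop :=
  {in neg_leaves G, forall x, f x \in pos_leaves G}.

Definition matching G (f : V -> V) : Prop :=
  forall P : X,
    [/\ {in labelled G (NVar P), forall x, f x \in labelled G (Var P)},
        {in labelled G (NVar P) &, injective f}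
      & {in labelled G (Var P), forall y,
          exists2 x, x \in labelled G (NVar P) & f x = y}].
End CutSequents.

(* Undirected multigraphs: a list of vertices, and a list of edges in which   *)
(* an edge is identified by its index.                                        *)
Section Multigraphs.
Variable V : eqType.
Implicit Types (E : seq (V * V)) (p : seq (nat * V)).

Definition joins E (i : nat) (x y : V) : bool :=
  (onth E i == Some (x, y)) || (onth E i == Some (y, x)).

(* The walk from x that follows edge i to vertex y for each (i, y) in p.      *)
Fixpoint walk E (x : V) p : bool :=
  if p is (i, y) :: p' then joins E i x y && walk E y p' else true.

Definition connected (W : seq V) E : Prop :=
  {in W &, forall x y, exists2 p, walk E x p & last x (unzip2 p) = y}.

(* Cycles of length 1 (loops) and 2 (parallel edges) are included. *)
Definition is_cycle E (x : V) p : Prop :=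
  [/\ p <> [::], walk E x p, last x (unzip2 p) = x,
      uniq (unzip1 p) & uniq (unzip2 p)].

Definition acyclic E : Prop := forall x p, ~ is_cycle E x p.

Definition is_tree (W : seq V) E : Prop := connected W E /\ acyclic E.
End Multigraphs.

Section ProofNets.
Variables X V : eqType.
Implicit Types (G : cut_forest X V) (f : V -> V).

Definition switching_edges (sw : V -> bool) G : seq (V * V) :=
  flatten (map (occ_edges sw) (trees G))
    ++ [seq (root_of k.1, root_of k.2) | k <- cuts G].

Definition leaf_edges G f : seq (V * V) := [seq (x, f x) | x <- neg_leaves G].

Definition switching G f : Prop :=
  forall sw : V -> bool,
    is_tree (vertices G) (switching_edges sw G ++ leaf_edges G f).

Definition proof_net G f : Prop :=
  [/\ leaf_function G f, matching G f & switching G f].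

Definition cut_between (k : occ X V * occ X V) (t u : occ X V) : Prop :=
  k = (t, u) \/ k = (u, t).

Inductive cut_elim :
    cut_forest X V * (V -> V) -> cut_forest X V * (V -> V) -> Prop :=
  | ElimAtom S c1 k c2 f x y a of
      cut_between k (OLeaf x a) (OLeaf y (dual_atom a)) & positive a :
      cut_elim (CutForest S (c1 ++ k :: c2), f)
               (CutForest S (c1 ++ c2),
                fun z => if f z == x then f y else f z)
  | ElimCompound S c1 k c2 f v w (tB tC uB uC : occ X V) of
      cut_between k (OTensor v tB tC) (OPar w uB uC) :
      cut_elim (CutForest S (c1 ++ k :: c2), f)
               (CutForest S (c1 ++ [:: (tB, uB), (tC, uC) & c2]), f).
End ProofNets.

Definition strongly_normalising (T : Type) (R : T -> T -> Prop) (x : T) : Prop :=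
  forall s : nat -> T, s 0 = x -> ~ (forall n, R (s n) (s n.+1)).

(* Main.v *)
Require Import Defs.
From mathcomp Require Import all_boot zify.

(** Each elimination removes exactly two vertices from the cut pairs: the two leaves of an atomic
    cut, or the two roots of a compound cut, whose subtrees are merely regrouped into new pairs. So
    [cuts_size] strictly decreases, which bounds the length of every reduction. *)

Definition cuts_size {X V : Type} (G : cut_forest X V) : nat :=
  sumn [seq size (occ_vertices k.1) + size (occ_vertices k.2) | k <- cuts G].

Lemma cut_elim_cuts_size (X V : eqType) (p q : cut_forest X V * (V -> V)) :
  cut_elim p q -> cuts_size q.1 < cuts_size p.1.
Proof.
by case=> [S c1 k c2 f x y a [] -> _ | S c1 k c2 f v w tB tC uB uC [] ->];
  rewrite /cuts_size /= !map_cat !sumn_cat /= ?size_cat; lia.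
Qed.

Lemma strongly_normalising_measure (T : Type) (R : T -> T -> Prop)
    (mu : T -> nat) (x : T) :
  (forall y z, R y z -> mu z < mu y) -> strongly_normalising R x.
Proof.
move=> mu_decr s _ Rs.
(* Each of the first [n] steps costs at least one unit of [mu]. *)
have bound n : mu (s n) + n <= mu (s 0).
  elim: n => [|n]; first by rewrite addn0.
  by apply: leq_trans; rewrite addnS -addSn leq_add2r mu_decr.
(* One step more than [mu (s 0)] already contradicts [bound]. *)
by have := leq_trans (leq_addl _ _) (bound (mu (s 0)).+1); rewrite ltnn.
Qed.

Theorem theorem3 (X V : eqType) (G : cut_forest X V) (f : V -> V) :
  cut_sequent G -> proof_net G f -> strongly_normalising (@cut_elim X V) (G, f).
Proof.
move=> _ _; apply: (strongly_normalising_measure _ _ (fun p => cuts_size p.1)).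
exact: cut_elim_cuts_size.
Qed.
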